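(* Let $(X,\triangleright)$ be a rack, let $A$ be a finite abelian group with a structure of $X$-module $(\eta_{ij}),(\tau_{ij})$, let $(\kappa_{ij})_{i,j\in X}$ be a $2$-cocycle on $X$ with values in $A$, and let $Y_\kappa=X\times_\kappa A$ be the corresponding affine module over $X$. Let $\widehat A$ be the group of characters of $A$. If $\mathfrak q$ is a $2$-cocycle on $Y_\kappa$ with values in $\mathbb C^\times$ given by $$\mathfrak q_{(i,a),(j,b)}=\chi_{i,j}(b)\,\mu_{i,j}(a)\,q_{ij}\qquad (i,j\in X,\ a,b\in A)$$ with $\chi_{i,j},\mu_{i,j}\in\widehat A$ and $q_{ij}\in\mathbb C^\times$, then, writing $$(i,\psi):=\sum_{a\in A}\psi(a)\,(i,a)\in\mathbb C Y_\kappa,\qquad i\in X,\ \psi\in\widehat A,$$ one has $$c^{\mathfrak q}\big((i,\psi)\otimes(j,\phi)\big)=F_{ij}^{\psi,\phi}\,(i\triangleright j,\vartheta)\otimes(i,\nu)$$ for all $i,j\in X$, $\psi,\phi\in\widehat A$, where $$F_{ij}^{\psi,\phi}=q_{ij}\,\phi(\widetilde\kappa_{ij})^{-1}\,\chi_{i,j}(\widetilde\kappa_{ij})^{-1},\qquad \vartheta=(\phi\chi_{i,j})\circ\eta_{i,j}^{-1},\qquad \nu=\psi\,\mu_{i,j}\,\big((\phi\chi_{i,j})\circ\widetilde\tau_{i,j}\big)^{-1},$$ and $\widetilde\tau_{i,j}(a)=\eta_{i,j}^{-1}(\tau_{i,j}(a))$, $\widetilde\kappa_{ij}=\eta_{i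,j}^{-1}(\kappa_{ij})$.
   Context: A rack is a pair $(X,\triangleright)$ where $X$ is a non-empty set and $\triangleright:X\times X\to X$ is such that each $j\mapsto i\triangleright j$ is a bijection of $X$ and $i\triangleright(j\triangleright k)=(i\triangleright j)\triangleright(i\triangleright k)$ for all $i,j,k$. A structure of $X$-module on an abelian group $A$ consists of $\eta_{ij}\in\mathrm{Aut}(A)$ and $\tau_{ij}\in\mathrm{End}(A)$, $i,j\in X$, with $\eta_{i,j\triangleright k}\eta_{j,k}=\eta_{i\triangleright j,i\triangleright k}\eta_{i,k}$, $\ \tau_{i,j\triangleright k}=\eta_{i\triangleright j,i\triangleright k}\tau_{i,k}+\tau_{i\triangleright j,i\triangleright k}\tau_{i,j}$, $\ \eta_{i,j\triangleright k}\tau_{j,k}=\tau_{i\triangleright j,i\triangleright k}\eta_{i,j}$ for all $i,j,k\in X$. A $2$-cocycle on $X$ with values in the $X$-module $A$ is a family $(\kappa_{ij})_{i,j\in X}$ in $A$ with $\eta_{i,j\triangleright k}(\kappa_{jk})+\kappa_{i,j\triangleright k}=\eta_{i\triangleright j,i\triangleright k}(\kappa_{ik})+\tau_{i\triangleright j,i\triangleright k}(\kappa_{ij})+\kappa_{i\triangleright j,i\triangleright k}$ for all $i,j,k$. The affine module $X\times_\kappa A$ is the rack $X\times A$ with $(i,a)\triangleright(j,b)=(i\triangleright j,\ \eta_{i,j}(b)+\tau_{i,j}(a)+\kappa_{ij})$. A $2$-cocycle on a rack $Y$ with values in $\mathbb C^\times$ is a function $\mathfrak q:Y\times Y\to\mathbb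 C^\times$ with $\mathfrak q_{x,y\triangleright z}\mathfrak q_{y,z}=\mathfrak q_{x\triangleright y,x\triangleright z}\mathfrak q_{x,z}$ for all $x,y,z\in Y$. $\mathbb CY$ is the complex vector space with basis $Y$, and $c^{\mathfrak q}:\mathbb CY\otimes\mathbb CY\to\mathbb CY\otimes\mathbb CY$ is the linear map $c^{\mathfrak q}(x\otimes y)=\mathfrak q_{x,y}\,(x\triangleright y)\otimes x$ for $x,y\in Y$. Characters are homomorphisms $A\to\mathbb C^\times$, multiplied pointwise. *)

(* Defs.v *)
From HB Require Import structures.
From mathcomp Require Import all_boot all_order all_algebra finmap.
From mathcomp Require Import ssrAC monalg.

Set Implicit Arguments.
Unset Strict Implicit.
Unset Printing Implicit Defensive.

Import GRing.Theory.
Local Open Scope ring_scope.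

Reserved Notation "i |> j" (at level 35, right associativity).

HB.mixin Record isRack X of Choice X := {
  rack_op : X -> X -> X;
  rack_inhabited : inhabited X;
  rack_bij : forall i, bijective (rack_op i);
  rack_dist : forall i j k,
    rack_op i (rack_op j k) = rack_op (rack_op i j) (rack_op i k)
}.

#[short(type="rackType")]
HB.structure Definition Rack := {X of isRack X & Choice X}.

Notation "i |> j" := (rack_op i j) : ring_scope.

Record zmod_aut (A : zmodType) := ZmodAut {
  aut_fun :> {additive A -> A};
  aut_inv : {additive A -> A};
  aut_funK : cancel aut_fun aut_inv;
  aut_invK : cancel aut_inv aut_fun
}.

Record rack_module (X : rackType) (A : zmodType) := RackModule {
  eta : X -> X -> zmod_aut A;
  tau : X -> X -> {additive A -> A};
  etaE : forall i j k a,
    eta i (j |> k) (eta j k a) = eta (i |> j) (i |> k) (eta i k a);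
  tauE : forall i j k a,
    tau i (j |> k) a =
      eta (i |> j) (i |> k) (tau i k a) + tau (i |> j) (i |> k) (tau i j a);
  eta_tau : forall i j k a,
    eta i (j |> k) (tau j k a) = tau (i |> j) (i |> k) (eta i j a)
}.

Record module_cocycle (X : rackType) (A : zmodType) (M : rack_module X A) :=
  ModuleCocycle {
    kappa_fun :> X -> X -> A;
    kappaE : forall i j k,
      eta M i (j |> k) (kappa_fun j k) + kappa_fun i (j |> k) =
        eta M (i |> j) (i |> k) (kappa_fun i k)
        + tau M (i |> j) (i |> k) (kappa_fun i j)
        + kappa_fun (i |> j) (i |> k)
  }.

(* The parameters M and kappa are phantom: they select the rack instance. *)
Definition affine_module (X : rackType) (A : zmodType) (M : rack_module X A)
  (kappa : module_cocycle M) : Type := (X * A)%type.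

Section AffineModule.
Variables (X : rackType) (A : zmodType) (M : rack_module X A).
Variable kappa : module_cocycle M.
Local Notation affine_module := (affine_module kappa).

HB.instance Definition _ := Choice.on affine_module.

Definition affine_op (x y : affine_module) : affine_module :=
  (x.1 |> y.1, eta M x.1 y.1 y.2 + tau M x.1 y.1 x.2 + kappa x.1 y.1).

Fact affine_inhabited : inhabited affine_module.
Proof. by case: (@rack_inhabited X) => i; exists; exact: (i, 0). Qed.

Fact affine_bij x : bijective (affine_op x).
Proof.
have [g gK Kg] := rack_bij x.1.
exists (fun y => (g y.1, aut_inv (eta M x.1 (g y.1))
                   (y.2 - kappa x.1 (g y.1) - tau M x.1 (g y.1) x.2))).
- by case=> j b; rewrite /affine_op /= gK !addrK aut_funK.
- by case=> k c; rewrite /affine_op /= aut_invK !subrK Kg.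
Qed.

Fact affine_dist x y z :
  affine_op x (affine_op y z) = affine_op (affine_op x y) (affine_op x z).
Proof.
case: x y z => [i a] [j b] [k c]; rewrite /affine_op /= rack_dist.
congr pair; rewrite !raddfD /= etaE tauE eta_tau !addrA.
rewrite [LHS](AC 6 ((1*2*4*5)*(3*6))) [RHS](AC 7 ((1*4*2*5)*(3*6*7))) /=.
by congr (_ + _); rewrite kappaE.
Qed.

HB.instance Definition _ :=
  isRack.Build affine_module affine_inhabited affine_bij affine_dist.

End AffineModule.

Section Character.
Variables (A : finZmodType) (F : fieldType).

Definition is_character (f : {ffun A -> F}) :=
  [forall a, f a != 0] && [forall a, forall b, f (a + b) == f a * f b].

Record character := Character {
  char_val :> {ffun A -> F};
  _ : is_character char_val
}.

HB.instance Definition _ := [isSub for char_val].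
HB.instance Definition _ := [Choice of character by <:].

Lemma is_characterP (f : {ffun A -> F}) :
  reflect ((forall a, f a != 0) /\ {morph f : a b / a + b >-> a * b})
          (is_character f).
Proof.
apply: (iffP andP) => -[f0 fM]; split.
- exact/forallP.
- by move=> a b; apply/eqP; move/forallP/(_ a)/forallP/(_ b): fM.
- exact/forallP.
- by apply/forallP => a; apply/forallP => b; rewrite fM.
Qed.

Lemma char_neq0 (f : character) a : f a != 0.
Proof. by case/is_characterP: (valP f). Qed.

Lemma charD (f : character) : {morph f : a b / a + b >-> a * b}.
Proof. by case/is_characterP: (valP f). Qed.

Fact char1_subproof : is_character [ffun=> 1].
Proof.
by apply/is_characterP; split=> [a|a b]; rewrite !ffunE ?oner_neq0 ?mulr1.
Qed.

Fact charM_subproof (f g : character) : is_character [ffun a => f a * g a].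
Proof.
apply/is_characterP; split=> [a|a b]; rewrite !ffunE ?mulf_neq0 ?char_neq0 //.
by rewrite !charD mulrACA.
Qed.

Fact charV_subproof (f : character) : is_character [ffun a => (f a)^-1].
Proof.
apply/is_characterP; split=> [a|a b]; rewrite !ffunE ?invr_neq0 ?char_neq0 //.
by rewrite charD invfM.
Qed.

Fact char_comp_subproof (f : character) (h : {additive A -> A}) :
  is_character [ffun a => f (h a)].
Proof.
apply/is_characterP; split=> [a|a b]; rewrite !ffunE ?char_neq0 //.
by rewrite raddfD charD.
Qed.

Definition char1 := Character char1_subproof.
Definition charM f g := Character (charM_subproof f g).
Definition charV f := Character (charV_subproof f).
Definition char_comp f h := Character (char_comp_subproof f h).

Lemma char1E a : char1 a = 1. Proof. exact: ffunE. Qed.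
Lemma charME f g a : charM f g a = f a * g a. Proof. exact: ffunE. Qed.
Lemma charVE f a : charV f a = (f a)^-1. Proof. exact: ffunE. Qed.
Lemma char_compE f h a : char_comp f h a = f (h a). Proof. exact: ffunE. Qed.

Lemma charP (f g : character) : f =1 g -> f = g.
Proof. by move=> fg; apply/val_inj/ffunP. Qed.

Fact charMA : associative charM.
Proof. by move=> f g h; apply: charP => a; rewrite !charME mulrA. Qed.
Fact char1M : left_id char1 charM.
Proof. by move=> f; apply: charP => a; rewrite charME char1E mul1r. Qed.
Fact charM1 : right_id char1 charM.
Proof. by move=> f; apply: charP => a; rewrite charME char1E mulr1. Qed.
Fact charVM : left_inverse char1 charV charM.
Proof.
by move=> f; apply: charP => a; rewrite charME charVE char1E mulVf ?char_neq0.
Qed.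
Fact charMV : right_inverse char1 charV charM.
Proof.
by move=> f; apply: charP => a; rewrite charME charVE char1E mulfV ?char_neq0.
Qed.

HB.instance Definition _ :=
  isGroup.Build character charMA char1M charM1 charVM charMV.

Lemma char_oneE a : (1%g : character) a = 1. Proof. exact: char1E. Qed.
Lemma char_mulE (f g : character) a : (f * g)%g a = f a * g a.
Proof. exact: charME. Qed.
Lemma char_invE (f : character) a : (f^-1)%g a = (f a)^-1.
Proof. exact: charVE. Qed.

End Character.

(* Linear extension of a map defined on the basis K of {malg F[K]}. *)
Section LinExt.
Variables (F : fieldType) (K : choiceType) (V : lmodType F) (f : K -> V).

Definition lin_ext (u : {malg F[K]}) : V := \sum_(k <- msupp u) u@_k *: f k.

Lemma lin_extEw (d : {fset K}) u : (msupp u `<=` d)%fset ->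
  lin_ext u = \sum_(k <- d) u@_k *: f k.
Proof.
move=> ud; rewrite /lin_ext (big_fset_incl _ ud) //= => k _ ku.
by rewrite mcoeff_outdom // scale0r.
Qed.

Fact lin_ext_is_linear : linear lin_ext.
Proof.
move=> c u v; pose d := (msupp u `|` msupp v `|` msupp (c *: u + v))%fset.
rewrite !(@lin_extEw d) ?scaler_sumr -?big_split /=; last first.
- by rewrite fsubsetUr.
- by apply: fsubset_trans (fsubsetUl _ _); rewrite fsubsetUl.
- by apply: fsubset_trans (fsubsetUl _ _); rewrite fsubsetUr.
by apply: eq_bigr => k _; rewrite mcoeffD mcoeffZ scalerDl scalerA.
Qed.

HB.instance Definition _ :=
  GRing.isLinear.Build F {malg F[K]} V *:%R lin_ext lin_ext_is_linear.

Lemma lin_extU k : lin_ext << k >> = f k.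
Proof. by rewrite /lin_ext msuppU oner_eq0 big_seq_fset1 mcoeffUU scale1r. Qed.

End LinExt.

Lemma malg_linear_eq (F : fieldType) (K : choiceType) (V : lmodType F)
    (g h : {malg F[K]} -> V) :
  linear g -> linear h -> (forall k, g << k >> = h << k >>) -> g =1 h.
Proof.
move=> gl hl gh u.
pose g' : {linear {malg F[K]} -> V} :=
  HB.pack g (GRing.isLinear.Build F {malg F[K]} V *:%R g gl).
pose h' : {linear {malg F[K]} -> V} :=
  HB.pack h (GRing.isLinear.Build F {malg F[K]} V *:%R h hl).
suff: g' u = h' u by [].
rewrite [u]monalgE !raddf_sum; apply: eq_bigr => k _.
have -> : << u@_k *g k >> = u@_k *: << k >> :> {malg F[K]}.
  by apply/malgP => l; rewrite mcoeffZ !mcoeffU mulrnAr mulr1.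
by apply: etrans (linearZ_LR g' _ _) _; rewrite [g' _]gh; apply/esym/linearZ_LR.
Qed.

(* The tensor product of the free modules on K and L is realised as the free
   module on K * L, with << x >> (x) << y >> = << (x, y) >>; tens_universal
   states its universal property. *)
Section Tensor.
Variables (F : fieldType) (K L : choiceType).

Definition tens (u : {malg F[K]}) (v : {malg F[L]}) : {malg F[(K * L)%type]} :=
  lin_ext (fun x => lin_ext (fun y => << (x, y) >>) v) u.

Lemma tensU x y : tens << x >> << y >> = << (x, y) >>.
Proof. by rewrite /tens !lin_extU. Qed.

Lemma tens_linearl v : linear (tens^~ v).
Proof. by move=> c u1 u2; rewrite /tens linearP. Qed.

Lemma tens_linearr u : linear (tens u).
Proof.
move=> c v1 v2.
have tensE v : tens u v =
  \sum_(x <- msupp u) u@_x *: lin_ext (fun y => << (x, y) >>) v by [].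
rewrite !tensE scaler_sumr -big_split /=; apply: eq_bigr => x _.
by rewrite linearP scalerDr !scalerA mulrC.
Qed.

Lemma tens_universal (V : lmodType F) (B : {malg F[K]} -> {malg F[L]} -> V) :
    (forall v, linear (B^~ v)) -> (forall u, linear (B u)) ->
  exists g : {linear {malg F[(K * L)%type]} -> V},
    (forall u v, g (tens u v) = B u v) /\
    (forall h : {linear {malg F[(K * L)%type]} -> V},
       (forall u v, h (tens u v) = B u v) -> h =1 g).
Proof.
move=> Bl Br; pose g := lin_ext (fun p => B << p.1 >> << p.2 >>).
have gl c u v : g (c *: u + v) = c *: g u + g v by rewrite /g linearP.
exists (lin_ext (fun p => B << p.1 >> << p.2 >>)); split=> [u v|h hB].
  apply: (malg_linear_eq (g := fun u => g (tens u v)) (h := B^~ v)) => // [|x].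
    by move=> c u1 u2; rewrite tens_linearl gl.
  apply: (malg_linear_eq (g := fun v => g (tens << x >> v))) => // [|y].
    by move=> c v1 v2; rewrite tens_linearr gl.
  by rewrite tensU; apply: etrans (lin_extU _ _) _.
apply: malg_linear_eq; [exact: linearP|exact: linearP|case=> x y].
by rewrite -tensU hB tensU; apply/esym/(etrans (lin_extU _ _)).
Qed.

End Tensor.

Section Braiding.
Variables (F : fieldType) (Y : rackType).

Definition rack_cocycle (q : Y -> Y -> F) : Prop :=
  (forall x y, q x y != 0) /\
  (forall x y z, q x (y |> z) * q y z = q (x |> y) (x |> z) * q x z).

Definition braiding (q : Y -> Y -> F) : {malg F[(Y * Y)%type]} -> {malg F[(Y * Y)%type]} :=
  lin_ext (fun p => q p.1 p.2 *: tens << p.1 |> p.2 >> << p.1 >>).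

HB.instance Definition _ q := GRing.Linear.on (braiding q).

Lemma braidingU q x y :
  braiding q (tens << x >> << y >>) = q x y *: tens << x |> y >> << x >>.
Proof. by rewrite tensU /braiding lin_extU. Qed.

End Braiding.

(* The vector written (i, psi) *)
Definition char_vec (F : fieldType) (X : rackType) (A : finZmodType)
    (M : rack_module X A) (kappa : module_cocycle M) (i : X)
    (psi : character A F) : {malg F[affine_module kappa]} :=
  \sum_(a : A) psi a *: << ((i, a) : affine_module kappa) >>.

(* Main.v *)
Require Import Defs.
From mathcomp Require Import all_boot all_order all_algebra.
From mathcomp Require Import monalg complex reals ring.

Set Implicit Arguments.
Unset Strict Implicit.
Unset Printing Implicit Defensive.

Import GRing.Theory.
Local Open Scope ring_scope.

(** The proof is a change of variables in a finite double sum. The braiding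
    sends the pair of basis vectors [(i, a)], [(j, b)] to a multiple of the pair
    [(i |> j, c)], [(i, a)], where [c = eta b + tau a + kappa]. For fixed [a],
    [b |-> c] is a translate of the automorphism [eta], hence a bijection
    of [A], so the sum over [(a, b)] becomes a sum over [(a, c)]. Applying
    [eta^-1] gives [eta^-1 c = b + tau_t a + kappa_t], and the character
    [phi * chi] splits along this decomposition: its value at [b] is its value
    at [eta^-1 c], which is the coefficient of [theta] at [c], divided by its
    values at [tau_t a], absorbed by [nu], and at [kappa_t], absorbed by the
    scalar factor. Thus the coefficients separate into a function of [c] times
    a function of [a] (lemma [char_separation]), and the double sum is a
    single tensor of two character vectors. *)

(** Used with [t = tau a + kappa] for fixed [a], to reindex the sum over [b]. *)
Lemma aut_translate_bij (A : zmodType) (e : zmod_aut A) (t : A) :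
  bijective (fun b => e b + t).
Proof.
exists (fun c => aut_inv e (c - t)) => [b|c]; first by rewrite addrK aut_funK.
by rewrite aut_invK subrK.
Qed.

Lemma tens_sum (F : fieldType) (K L : choiceType) (I J : finType)
    (c : I -> F) (x : I -> K) (d : J -> F) (y : J -> L) :
  tens (\sum_i c i *: << x i >>) (\sum_j d j *: << y j >>) =
  \sum_i \sum_j (c i * d j) *: tens << x i >> << y j >>.
Proof.
rewrite /tens linear_sum; apply: eq_bigr => i _.
rewrite linearZ_LR /= lin_extU [X in _ *: X](linear_sum (lin_ext _)).
rewrite scaler_sumr.
by apply: eq_bigr => j _; rewrite linearZ_LR /= lin_extU scalerA !lin_extU.
Qed.

(** Here [t] and [k] stand for [tau_t a] and [kappa_t]. With [xi = phi * chi]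
    evaluated at [eta^-1 c = b + t + k], the factors [xi t] and [xi k] are
    cancelled by the inverses carried by [nu] and by the scalar factor, leaving
    [xi b]. *)
Lemma char_separation (A : finZmodType) (F : fieldType)
    (psi phi chi mu : character A F) (q0 : F) (a b t k : A) :
  psi a * phi b * (chi b * mu a * q0) =
  q0 * (phi k)^-1 * (chi k)^-1 *
    ((phi * chi)%g (b + t + k) * (psi a * mu a * ((phi * chi)%g t)^-1)).
Proof.
rewrite !char_mulE !charD.
have := (char_neq0 phi t, char_neq0 phi k, char_neq0 chi t, char_neq0 chi k).
move=> [[[pt pk] ct] ck].
by field; rewrite pt pk ct ck.
Qed.

Theorem theorem5p13 (R : realType) (X : rackType) (A : finZmodType)
  (M : rack_module X A) (kappa : module_cocycle M)
  (q : affine_module kappa -> affine_module kappa -> R[i])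
  (chi mu : X -> X -> character A R[i]) (q0 : X -> X -> R[i])
  (q_cocycle : rack_cocycle q)
  (q0_neq0 : forall i j : X, q0 i j != 0)
  (qE : forall (i j : X) (a b : A),
     q (i, a) (j, b) = chi i j b * mu i j a * q0 i j)
  (i j : X) (psi phi : character A R[i]) :
  let eta_inv := aut_inv (eta M i j) in
  let tau_t : {additive A -> A} := eta_inv \o tau M i j in
  let kappa_t : A := eta_inv (kappa i j) in
  let Fij : R[i] := q0 i j * (phi kappa_t)^-1 * (chi i j kappa_t)^-1 in
  let theta := char_comp (phi * chi i j)%g eta_inv in
  let nu := (psi * mu i j * (char_comp (phi * chi i j) tau_t)^-1)%g in
  braiding q (tens (char_vec kappa i psi) (char_vec kappa j phi))
    = Fij *: tens (char_vec kappa (i |> j) theta) (char_vec kappa i nu).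
Proof.
move=> eta_inv tau_t kappa_t Fij theta nu.
have thetaE c : theta c = (phi * chi i j)%g (eta_inv c) by exact: char_compE.
have nuE a : nu a = psi a * mu i j a * ((phi * chi i j)%g (tau_t a))^-1.
  by rewrite /nu !(char_mulE, char_invE, char_compE).
(* Kept opaque so that simplification does not expand the characters. *)
clearbody theta nu.
rewrite /char_vec !tens_sum linear_sum [in RHS]exchange_big scaler_sumr /=.
apply: eq_bigr => a _.
pose e b := eta M i j b + (tau M i j a + kappa i j).
have [e_inv eK e_invK] : bijective e by exact: aut_translate_bij.
rewrite linear_sum scaler_sumr [RHS](reindex e) /=; last first.
  by exists e_inv => c _; [exact: eK|exact: e_invK].
apply: eq_bigr => b _.
rewrite linearZ_LR /= braidingU qE !scalerA.
have -> : ((i, a) : affine_module kappa) |> (j, b) = (i |> j, e b).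
  by rewrite /e addrA.
congr (_ *: _).
have eta_inv_e : eta_inv (e b) = b + tau_t a + kappa_t.
  by rewrite /e !raddfD /= /eta_inv aut_funK addrA.
rewrite thetaE nuE eta_inv_e; exact: char_separation.
Qed.
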